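(* Let $\mathfrak t$ be a nonnegative sesquilinear form in a complex Hilbert space $\mathfrak H$ and let $Q$ be a representing map for $\mathfrak t$, i.e. a linear operator from $\mathfrak H$ to a Hilbert space $\mathfrak K$ with $\operatorname{dom}Q=\operatorname{dom}\mathfrak t$ and $$\mathfrak t[\varphi,\psi]=(Q\varphi,Q\psi)_{\mathfrak K},\qquad\varphi,\psi\in\operatorname{dom}Q,$$ and, consequently, $$m(\mathfrak t)=\inf\left\{\frac{\|Q\varphi\|^2}{\|\varphi\|^2}:\ \varphi\in\operatorname{dom}Q,\ \varphi\ne0\right\}.$$ Then $\mathfrak t$ is singular if and only if $Q$ is singular, and in this case $m(\mathfrak t)=0$.
   Context: A (sesquilinear) form $\mathfrak t$ in $\mathfrak H$ is a map $\operatorname{dom}\mathfrak t\times\operatorname{dom}\mathfrak t\to\mathbb C$, linear in the first and antilinear in the second entry, where $\operatorname{dom}\mathfrak t$ is a (not necessarily dense) linear subspace of $\mathfrak H$; $\mathfrak t[\varphi]=\mathfrak t[\varphi,\varphi]$. It is nonnegative if $\mathfrak t[\varphi]\ge0$ for all $\varphi\in\operatorname{dom}\mathfrak t$. The lower bound $m(\mathfrak t)\in\mathbb R$ is the greatest $c\in\mathbb R$ with $\mathfrak t[\varphi]\ge c\|\varphi\|^2$ for all $\varphi\in\operatorname{dom}\mathfrak t$ (so $\operatorname{dom}\mathfrak t\ne\{0\}$ is understood). A nonnegative form $\mathfrak t$ is singular if for every $\varphi\in\operatorname{dom}\mathfrak t$ there is a sequence $\varphi_n\in\operatorname{dom}\mathfrak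 t$ with $\varphi_n\to\varphi$ in $\mathfrak H$ and $\mathfrak t[\varphi_n]\to0$. A linear operator $Q$ from $\mathfrak H$ to $\mathfrak K$ (not necessarily densely defined or closable) is singular if $\operatorname{dom}Q\subset\ker Q^{**}$, equivalently $\operatorname{ran}Q\subset\operatorname{mul}Q^{**}$. Here $Q^{**}\subset\mathfrak H\times\mathfrak K$ is the closure of the graph of $Q$ (a closed linear relation), $\ker Q^{**}=\{\varphi:\{\varphi,0\}\in Q^{**}\}$ and $\operatorname{mul}Q^{**}=\{\omega:\{0,\omega\}\in Q^{**}\}$. *)

(* Defs.v *)
From HB Require Import structures.
From mathcomp Require Import all_boot all_order all_algebra sesquilinear complex.
From mathcomp Require Import all_classical all_reals all_analysis.

Set Implicit Arguments.
Unset Strict Implicit.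
Unset Printing Implicit Defensive.

Import Order.TTheory GRing.Theory Num.Theory.
Import numFieldNormedType.Exports.

Local Open Scope classical_set_scope.
Local Open Scope complex_scope.
Local Open Scope ring_scope.

(* The inner product is linear in its first argument and antilinear in the
   second, as in [{dot _ for _}]. The norm of a normed module over [R[i]] takes
   its (real, nonnegative) values in [R[i]]. *)
HB.mixin Record isHilbert (R : realType) (H : Type)
    of CompleteNormedModule R[i] H := {
  inner : {dot H for @Num.conj R[i]};
  normr_inner : forall x : H, `|x| ^+ 2 = inner x x
}.

#[short(type="hilbertType")]
HB.structure Definition Hilbert (R : realType) :=
  {H of isHilbert R H & CompleteNormedModule R[i] H}.

Section Forms.
Variables (R : realType) (H : hilbertType R).

(* The values of [form_fun] outside of [form_dom] are irrelevant; none of the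
   notions below depends on them. *)
Record sesquiForm := SesquiForm {
  form_dom : set H;
  form_fun :> H -> H -> R[i];
  form_dom_submod : submod_closed [in form_dom];
  form_linearl : forall a u v psi,
    form_dom u -> form_dom v -> form_dom psi ->
    form_fun (a *: u + v) psi = a * form_fun u psi + form_fun v psi;
  form_antilinearr : forall a phi u v,
    form_dom phi -> form_dom u -> form_dom v ->
    form_fun phi (a *: u + v) = a^* * form_fun phi u + form_fun phi v
}.

Implicit Types t : sesquiForm.

(* In [R[i]], [0 <= z] says that [z] is real and nonnegative. *)
Definition nonneg_form t := forall phi, form_dom t phi -> 0 <= t phi phi.

Definition nontrivial_form t := exists2 phi, form_dom t phi & phi != 0.

Definition form_lbounds t : set R :=
  [set c | forall phi, form_dom t phi -> c%:C * `|phi| ^+ 2 <= t phi phi].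

(* [is_form_bound t m] reads m(t) = m. It holds for no [m] if [dom t = {0}],
   since then every real number belongs to [form_lbounds t]. *)
Definition is_form_bound t (m : R) :=
  form_lbounds t m /\ ubound (form_lbounds t) m.

Definition singular_form t :=
  forall phi, form_dom t phi ->
  exists u : nat -> H,
    [/\ forall n, form_dom t (u n),
        u @ \oo --> phi
      & (fun n => t (u n) (u n) : R[i]^o) @ \oo --> (0 : R[i]^o)].

End Forms.

Section Operators.
Variables (R : realType) (H K : hilbertType R).

(* As for forms, the values of [op_fun] outside of [op_dom] are irrelevant. *)
Record operator := Operator {
  op_dom : set H;
  op_fun :> H -> K;
  op_dom_submod : submod_closed [in op_dom];
  op_linear : forall a u v, op_dom u -> op_dom v ->
    op_fun (a *: u + v) = a *: op_fun u + op_fun v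
}.

Implicit Types Q : operator.

Definition op_graph Q : set (H * K) := [set p | op_dom Q p.1 /\ p.2 = Q p.1].

Definition ker_rel (A : set (H * K)) : set H := [set phi | A (phi, 0)].

(* The closed linear relation Q^** in H x K. *)
Definition op_closure Q : set (H * K) := closure (op_graph Q).

Definition singular_op Q := op_dom Q `<=` ker_rel (op_closure Q).

Definition representing_map (t : sesquiForm H) Q :=
  op_dom Q = form_dom t /\
  forall phi psi, op_dom Q phi -> op_dom Q psi ->
    t phi psi = inner (Q phi) (Q psi).

Definition op_quotients Q : set R :=
  [set r | exists phi,
    [/\ op_dom Q phi, phi != 0 & r%:C = `|Q phi| ^+ 2 / `|phi| ^+ 2]].

End Operators.

(* Main.v *)
(* For a representing map, t[u] = ||Q u||^2, so t[u_n] -> 0 if and only if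
   Q u_n -> 0. Since the closure in H x K is reached by sequences, this makes
   the two notions of singularity agree. If moreover u_n -> phi != 0 with
   t[u_n] -> 0, passing to the limit in c ||u_n||^2 <= t[u_n] forces c <= 0
   for every lower bound c of t. *)
Require Import Defs.
From mathcomp Require Import all_boot all_order all_algebra.
From mathcomp Require Import complex.
From mathcomp Require Import all_classical all_reals all_analysis.
Set Implicit Arguments.
Unset Strict Implicit.
Unset Printing Implicit Defensive.

Import Order.TTheory GRing.Theory Num.Theory.
Import numFieldNormedType.Exports.
Local Open Scope classical_set_scope.
Local Open Scope complex_scope.
Local Open Scope ring_scope.

Lemma representing_map_normr (R : realType) (H K : hilbertType R)
    (t : sesquiForm H) (Q : operator H K) :
  representing_map t Q ->
  forall phi, form_dom t phi -> t phi phi = `|Q phi| ^+ 2.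
Proof. by move=> [dQ tE] phi tphi; rewrite normr_inner tE // dQ. Qed.

(** For [phi != 0] the inequality that defines a lower bound can be divided by [|phi|^2]; at
    [phi = 0] its left side vanishes, so it imposes nothing on [c]. *)
Lemma form_lboundsE (R : realType) (H K : hilbertType R)
    (t : sesquiForm H) (Q : operator H K) :
  representing_map t Q ->
  form_lbounds t = lbound (op_quotients Q).
Proof.
move=> tQ; have tn := representing_map_normr tQ; have [dQ _] := tQ.
apply/seteqP; split=> c cl.
  move=> r [phi [Qphi phi0 rE]].
  rewrite -lecR rE ler_pdivlMr ?exprn_gt0 ?normr_gt0 //.
  by rewrite -tn -?dQ //; apply: cl; rewrite -dQ.
move=> phi tphi; rewrite tn //.
have [->|phi0] := eqVneq phi 0; first by rewrite normr0 expr0n mulr0 exprn_ge0.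
rewrite -ler_pdivlMr ?exprn_gt0 ?normr_gt0 //.
(* The quotient lives in [R[i]]; being nonnegative, it is real and coincides with its real part,
   which is the member of [op_quotients Q] to use. *)
have rE : (complex.Re (`|Q phi| ^+ 2 / `|phi| ^+ 2))%:C =
    `|Q phi| ^+ 2 / `|phi| ^+ 2.
  by apply: RRe_real; apply: ger0_real; rewrite divr_ge0 ?exprn_ge0.
by rewrite -rE lecR; apply: cl; exists phi; split; rewrite ?dQ.
Qed.

Lemma is_form_bound_inf (R : realType) (H K : hilbertType R)
    (t : sesquiForm H) (Q : operator H K) :
  representing_map t Q -> nontrivial_form t ->
  is_form_bound t (inf (op_quotients Q)).
Proof.
move=> tQ [phi tphi phi0]; have [dQ _] := tQ.
(* [inf] is the greatest lower bound only for a nonempty set bounded below: 0 supplies the bound,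
   [phi] the element. *)
have Q_lb0 : lbound (op_quotients Q) 0.
  by move=> r [psi [_ _ rE]]; rewrite -lecR rE divr_ge0 ?exprn_ge0.
have Q_nonempty : op_quotients Q !=set0.
  exists (complex.Re (`|Q phi| ^+ 2 / `|phi| ^+ 2)), phi; split; rewrite ?dQ //.
  by apply: RRe_real; apply: ger0_real; rewrite divr_ge0 ?exprn_ge0.
rewrite /is_form_bound (form_lboundsE tQ); split=> [r Qr|c Qc].
  by apply: ge_inf => //; exists 0.
exact: lb_le_inf.
Qed.

(** Balls of the product are products of balls of equal radius, so one [e] controls both
    components. *)
Lemma op_closureP (R : realType) (H K : hilbertType R) (Q : operator H K) x y :
  op_closure Q (x, y) <->
  forall e : R[i], 0 < e ->
    exists u, [/\ op_dom Q u, `|x - u| < e & `|y - Q u| < e].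
Proof.
split=> [Qxy e e0|Qxy B /nbhs_ballP[e /= e0 xyB]].
  have [] := Qxy (ball (x, y) e); first exact: nbhsx_ballx.
  by move=> [u v] /= [[/= Qu ->]] [/=]; rewrite -!ball_normE /=; exists u.
have [u [Qu xu yQu]] := Qxy e e0.
exists (u, Q u); split=> //; apply: xyB.
by split; rewrite /= -ball_normE.
Qed.

Lemma cvg_natSinv (R : realType) (V : normedModType R[i]) (u : nat -> V) (l : V) :
  (forall n, `|l - u n| < (n.+1%:R^-1 : R)%:C) -> u @ \oo --> l.
Proof.
move=> ul; apply/cvgrPdist_lt => e e0.
have eE : (complex.Re e)%:C = e by apply/RRe_real/gtr0_real.
have e'0 : 0 < complex.Re e by rewrite -ltcR eE.
near=> n; apply: (lt_trans (ul n)); rewrite -eE ltcR.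
by near: n; apply: (near_infty_natSinv_lt (PosNum e'0)).
Unshelve. all: by end_near. Qed.

Lemma singular_form_opP (R : realType) (H K : hilbertType R)
    (t : sesquiForm H) (Q : operator H K) :
  representing_map t Q -> singular_form t <-> singular_op Q.
Proof.
move=> tQ; have [dQ _] := tQ.
have tn u : op_dom Q u -> `|t u u| = `|Q u| ^+ 2.
  move=> Qu; rewrite (representing_map_normr tQ) -?dQ //.
  by rewrite ger0_norm ?exprn_ge0.
split=> [ts phi|Qs phi].
  rewrite dQ => /ts[u [tu uphi tu0]]; apply/op_closureP => e e0.
  move/cvgrPdist_lt/(_ _ e0) : uphi => u_near.
  (* The radius is [e^2] because [t[u_n]] is the square of the norm of [Q u_n]. *)
  move/cvgrPdist_lt/(_ _ (exprn_gt0 2 e0)) : tu0 => tu_near.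
  have [n _ /(_ n (leqnn n)) [n1 n2]] := filterI u_near tu_near.
  exists (u n); split; rewrite ?dQ // sub0r normrN.
  rewrite -(ltr_pXn2r (n := 2)) ?nnegrE ?normr_ge0 ?(ltW e0) // -tn ?dQ //.
  by move: n2; rewrite sub0r normrN.
rewrite -dQ => /Qs/op_closureP Qphi.
have Sinv_gt0 n : 0 < (n.+1%:R^-1 : R)%:C by rewrite ltcR invr_gt0.
have [u uP] := choice (fun n => Qphi _ (Sinv_gt0 n)).
exists u; split=> [n||].
- by have [] := uP n.
- by apply: cvg_natSinv => n; have [] := uP n.
apply: cvg_natSinv => n; have [Qu _] := uP n.
rewrite !sub0r !normrN => Qun; rewrite [X in X < _]tn //.
(* Since the norm of [Q u_n] is below [1/(n+1) <= 1], its square is no larger than itself, so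
   [t[u_n]] obeys the same rate. *)
apply: le_lt_trans (Qun); rewrite expr2 ler_piMl //.
by apply: le_trans (ltW Qun) _; rewrite (lecR _ 1) invf_le1 // ler1n.
Qed.

Lemma singular_form_bound (R : realType) (H : hilbertType R) (t : sesquiForm H) :
  nonneg_form t -> nontrivial_form t -> singular_form t -> is_form_bound t 0.
Proof.
move=> t0 [phi tphi phi0] ts; split=> [psi tpsi|c tc].
  by rewrite mul0r t0.
rewrite leNgt; apply/negP => c0.
have c0' : 0 < c%:C by rewrite ltcR.
(* Beyond some index [u_n] is within [|phi|/2] of [phi], hence has norm at least [|phi|/2]. A
   positive bound [c] then keeps [t[u_n]] at or above [c (|phi|/2)^2], the very threshold that
   [t[u_n] -> 0] passes below. *)
have half_gt0 : 0 < `|phi| / 2 by rewrite divr_gt0 ?normr_gt0.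
have [u [tu uphi tu0]] := ts _ tphi.
move/cvgrPdist_lt/(_ _ half_gt0) : uphi => u_near.
move/cvgrPdist_lt/(_ _ (mulr_gt0 c0' (exprn_gt0 2 half_gt0))) : tu0 => tu_near.
have [n _ /(_ n (leqnn n)) [un tun]] := filterI u_near tu_near.
have half_le : `|phi| / 2 <= `|u n|.
  rewrite -(lerD2l (`|phi| / 2)) -splitr -{1}(subrK (u n) phi).
  by apply: le_trans (ler_normD _ _) _; rewrite lerD2r ltW.
have : c%:C * (`|phi| / 2) ^+ 2 < c%:C * (`|phi| / 2) ^+ 2.
  apply: le_lt_trans tun; rewrite sub0r normrN [X in _ <= X]ger0_norm ?t0 //.
  apply: le_trans (tc _ (tu n)); rewrite ler_wpM2l ?(ltW c0') //.
  by rewrite lerXn2r ?nnegrE ?(ltW half_gt0).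
by rewrite ltxx.
Qed.

Theorem lemma2p8 (R : realType) (H K : hilbertType R)
    (t : sesquiForm H) (Q : operator H K) :
  nonneg_form t ->
  representing_map t Q ->
  [/\ nontrivial_form t -> is_form_bound t (inf (op_quotients Q)),
      singular_form t <-> singular_op Q
    & nontrivial_form t -> singular_form t -> is_form_bound t 0].
Proof.
move=> t0 tQ; split; first exact: is_form_bound_inf.
  exact: singular_form_opP.
exact: singular_form_bound.
Qed.
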